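(* Let $k\geq 2$. The limit $L_k=\lim_{n\to\infty} M_k(n)/k^{2n}$ exists. Furthermore, for every $n\geq 1$, \[\Big(\sum_{i=1}^{n}u_ik^{-2i}\Big)^2\leq L_k\leq\Big(\Big(\sum_{i=1}^{n}u_ik^{-2i}\Big)+\frac{k^{-n}}{k-1}\Big)^2.\]
   Context: $\Sigma_k=\{0,1,\ldots,k-1\}$ and $\Sigma_k^n$ is the set of length-$n$ words over $\Sigma_k$. A border of a word $w$ is a non-empty word that is both a proper prefix and a proper suffix of $w$; $w$ is unbordered if it has no border. $u_i$ denotes the number of unbordered words in $\Sigma_k^i$. A pair of words $(u,v)$ is mutually bordered if there is a non-empty word that is a proper suffix of $u$ and a proper prefix of $v$, and there is a non-empty word that is a proper prefix of $u$ and a proper suffix of $v$. $M_k(n)$ is the number of mutually bordered pairs $(u,v)\in\Sigma_k^n\times\Sigma_k^n$. *)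

(* Defs.v *)
From mathcomp Require Import all_boot all_order all_algebra.
From mathcomp Require Import boolp.

Set Implicit Arguments.
Unset Strict Implicit.
Unset Printing Implicit Defensive.

Definition proper_prefix (T : eqType) (x w : seq T) : bool :=
  prefix x w && (x != w).

Definition proper_suffix (T : eqType) (x w : seq T) : bool :=
  suffix x w && (x != w).

Definition border (T : eqType) (x w : seq T) : bool :=
  [&& x != [::], proper_prefix x w & proper_suffix x w].

Definition unbordered (T : eqType) (w : seq T) : Prop :=
  ~ exists x : seq T, border x w.

Definition mutually_bordered (T : eqType) (u v : seq T) : Prop :=
  (exists x : seq T, [&& x != [::], proper_suffix x u & proper_prefix x v]) /\
  (exists y : seq T, [&& y != [::], proper_prefix y u & proper_suffix y v]).

Definition num_unbordered (k i : nat) : nat :=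
  #|[pred w : i.-tuple 'I_k | `[< unbordered w >]]|.

Definition num_mutually_bordered (k n : nat) : nat :=
  #|[pred p : n.-tuple 'I_k * n.-tuple 'I_k
      | `[< mutually_bordered p.1 p.2 >]]|.

(* Main.v *)
(* A shortest word that is both a suffix of u and a prefix of v is unbordered,
   and an unbordered one is shortest.  So the events "the shortest overlap of
   (u, v) has length i" are disjoint and have probability u_i k^(-2i); summing,
   an overlap of length at most m has probability S_m, the m-th partial sum.
   For 2m <= n the overlaps of length at most m of (u, v) and of (v, u) involve
   disjoint letters, hence both exist with probability S_m^2, while an overlap of
   length in (m, n] has probability S_n - S_m.  Therefore
   S_m^2 <= M_k(n) / k^(2n) <= S_m^2 + 2 (S_n - S_m), and m = n/2 gives
   L_k = (lim S_n)^2.  The bounds follow from u_i <= k^i, which bounds the tail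
   of the series by a geometric one. *)
Require Import Defs.
From mathcomp Require Import all_boot all_order all_algebra.
From mathcomp Require Import boolp.
From mathcomp Require Import zify.

Set Implicit Arguments.
Unset Strict Implicit.

(** * Overlaps of two words, indexed by length *)

Section Overlap.
Variable T : eqType.
Implicit Types (u v w x : seq T) (i j m n : nat).

(** An overlap is encoded by its length, so that searching for one is a bounded boolean test. The
    subtraction truncates: the intended reading needs [i] to be at most both sizes. *)
Definition overlap i u v : bool := drop (size u - i) u == take i v.

(** Lengths start at 1 because the empty word is always an overlap. *)
Definition overlapping m u v : bool := has (fun i => overlap i u v) (iota 1 m).

Lemma overlappingS m u v :
  overlapping m.+1 u v = overlapping m u v || overlap m.+1 u v.
Proof.
by rewrite /overlapping -[in iota 1 m.+1](addn1 m) iotaD has_cat /= orbF add1n.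
Qed.

Lemma overlapping_mono m n u v :
  m <= n -> overlapping m u v -> overlapping n u v.
Proof.
move=> mn /hasP[i]; rewrite mem_iota => im ov.
by apply/hasP; exists i => //; rewrite mem_iota; lia.
Qed.

(** The last [j] letters of [u] lie inside its last [i] letters, which spell [take i v]. *)
Lemma overlap_take i j u v : j <= i -> i <= size u -> i <= size v ->
  overlap i u v -> overlap j u v = overlap j (take i v) (take i v).
Proof.
move=> ji iu iv /eqP ov; rewrite /overlap size_takel // -[in RHS]ov drop_drop.
by rewrite ov take_takel // addnC addnBA // subnK.
Qed.

(** Hence an overlap is the shortest one exactly when the common word is unbordered. *)
Lemma overlapping_take i u v : i < size u -> i < size v -> overlap i.+1 u v ->
  overlapping i u v = overlapping i (take i.+1 v) (take i.+1 v).
Proof.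
move=> iu iv ov; apply: eq_in_has => j; rewrite mem_iota => jm.
by apply: overlap_take => //; lia.
Qed.

(** This locality is what makes the two directions independent when [m] is at most half the
    length. *)
Lemma overlapping_ends m u v : m <= size u -> m <= size v ->
  overlapping m u v = overlapping m (drop (size u - m) u) (take m v).
Proof.
move=> mu mv; apply: eq_in_has => j; rewrite mem_iota => jm.
rewrite /overlap size_drop drop_drop take_takel; last lia.
by congr (drop _ _ == _); lia.
Qed.

(** The bound is [n.-1] because properness on words of length [n] rules out exactly the length
    [n]. *)
Lemma proper_overlapP n u v : size u = n -> size v = n ->
  reflect (exists x, [&& x != [::], proper_suffix x u & proper_prefix x v])
          (overlapping n.-1 u v).
Proof.
move=> su sv; apply: (iffP hasP) => [[i]|[x /and3P[x0]]].
  rewrite mem_iota => im /eqP ov; exists (take i v).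
  have si : size (take i v) = i by rewrite size_takel; lia.
  apply/and3P; split; first by rewrite -size_eq0 si; lia.
    rewrite /proper_suffix -[in suffix _ _]ov suffix_drop /=.
    by apply/eqP => /(congr1 size); rewrite si; lia.
  rewrite /proper_prefix prefix_take /=.
  by apply/eqP => /(congr1 size); rewrite si; lia.
move=> /andP[/suffixP[y uE] xu] /andP[/prefixP[z vE] xv].
exists (size x).
  rewrite mem_iota lt0n size_eq0 x0 /=.
  (* Properness of the suffix [x] forces a non-empty remainder [y], so [size x < n]. *)
  have : size y != 0 by apply: contra xu; rewrite uE size_eq0 => /eqP->.
  by move/(congr1 size): uE; rewrite size_cat; lia.
by rewrite /overlap uE vE take_size_cat // size_cat addnK drop_size_cat.
Qed.

Lemma unborderedE n w : size w = n -> unbordered w <-> ~~ overlapping n.-1 w w.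
Proof.
move=> sw; split=> [uw|/(proper_overlapP sw sw) ov].
  apply/(proper_overlapP sw sw) => -[x /and3P[x0 xs xp]].
  by apply: uw; exists x; apply/and3P.
by move=> [x /and3P[x0 xp xs]]; apply: ov; exists x; apply/and3P.
Qed.

End Overlap.

(** * Counting pairs of words by their overlaps *)

Section Counting.
Variable k : nat.
Implicit Types (i m n : nat).

Lemma card_word n : #|{: n.-tuple 'I_k}| = k ^ n.
Proof. by rewrite card_tuple card_ord. Qed.

Lemma num_unbordered_le n : num_unbordered k n <= k ^ n.
Proof. by rewrite -card_word; apply: max_card. Qed.

(** Such pairs are uniquely of the form (yx, xz) with x unbordered of length [i.+1] and y, z
    arbitrary of length [n - i.+1]. *)
Lemma card_first_overlap n i : i < n ->
  #|[set p : n.-tuple 'I_k * n.-tuple 'I_k |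
      overlap i.+1 p.1 p.2 && ~~ overlapping i p.1 p.2]|
  = num_unbordered k i.+1 * k ^ (2 * (n - i.+1)).
Proof.
move=> lt_in.
have e1 : (n - i.+1) + i.+1 = n by rewrite subnK.
have e2 : i.+1 + (n - i.+1) = n by rewrite subnKC.
(* The map (x, (y, z)) to (yx, xz); [tcast] only adjusts the length in the type. *)
pose f (t : i.+1.-tuple 'I_k *
            ((n - i.+1).-tuple 'I_k * (n - i.+1).-tuple 'I_k)) :=
  (tcast e1 (cat_tuple t.2.1 t.1), tcast e2 (cat_tuple t.1 t.2.2)).
have f_inj : injective f.
  move=> [x [y z]] [x' [y' z']] [] /(congr1 (@tval _ _)) + /(congr1 (@tval _ _)).
  rewrite !val_tcast /= => /eqP + /eqP.
  rewrite !eqseq_cat ?size_tuple // => /andP[/eqP yE _] /andP[/eqP xE /eqP zE].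
  by congr (_, (_, _)); apply: val_inj.
pose U := [set x : i.+1.-tuple 'I_k | `[< unbordered x >]].
transitivity #|f @: setX U [set: _]|; last first.
  rewrite card_imset // cardsX cardsT card_prod !card_word mul2n -addnn expnD.
  by rewrite /U cardsE.
apply: eq_card => -[u v]; rewrite !inE /=.
have su := size_tuple u; have sv := size_tuple v.
apply/idP/imsetP => [/andP[ov nov]|[[x [y z]]]].
  have sx : size (take i.+1 v) == i.+1 by rewrite size_takel // sv.
  have sy : size (take (n - i.+1) u) == n - i.+1 by rewrite size_takel //; lia.
  have sz : size (drop i.+1 v) == n - i.+1 by rewrite size_drop sv.
  exists (Tuple sx, (Tuple sy, Tuple sz)).
    rewrite !inE andbT; apply/asboolP/(unborderedE (eqP sx)) => /=.
    by rewrite -(overlapping_take _ _ ov) ?su ?sv.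
  congr (_, _); apply: val_inj; rewrite /= val_tcast /=; last by rewrite cat_take_drop.
  by rewrite -(eqP ov) su cat_take_drop.
rewrite !inE andbT => /asboolP ux [uE vE].
have {}uE : u = y ++ x :> seq _ by rewrite uE val_tcast.
have {}vE : v = x ++ z :> seq _ by rewrite vE val_tcast.
have tE : take i.+1 v = x by rewrite vE take_size_cat ?size_tuple.
have ov : overlap i.+1 u v.
  by rewrite /overlap tE su uE drop_size_cat // size_tuple.
rewrite ov (overlapping_take _ _ ov) ?su ?sv // tE.
by apply/(unborderedE (size_tuple x)).
Qed.

(** Each step of the induction adds the pairs whose shortest overlap has length [m.+1], which are
    disjoint from the earlier ones. *)
Lemma card_overlapping n m : m <= n ->
  #|[set p : n.-tuple 'I_k * n.-tuple 'I_k | overlapping m p.1 p.2]|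
  = \sum_(1 <= i < m.+1) num_unbordered k i * k ^ (2 * (n - i)).
Proof.
elim: m => [|m IHm] mn.
  rewrite big_geq //; apply/eqP; rewrite cards_eq0; apply/eqP/setP => p.
  by rewrite !inE.
rewrite big_nat_recr //= -IHm ?(ltnW mn) // -card_first_overlap //.
rewrite -cardsUI [X in _ = _ + X]eq_card0 ?addn0; last first.
  by move=> p; rewrite !inE; case: overlapping; rewrite ?andbF.
apply: eq_card => p; rewrite !inE overlappingS.
by case: overlapping; rewrite ?andbT.
Qed.

(* For [2 * m <= n] the two events look at disjoint letters, so the count factors. *)
Lemma card_mutually_overlapping n m : 2 * m <= n ->
  #|[set p : n.-tuple 'I_k * n.-tuple 'I_k |
      overlapping m p.1 p.2 && overlapping m p.2 p.1]|
  = #|[set p : m.-tuple 'I_k * m.-tuple 'I_k | overlapping m p.1 p.2]| ^ 2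
    * k ^ (2 * (n - 2 * m)).
Proof.
move=> le_mn.
have e : m + ((n - 2 * m) + m) = n by lia.
pose W := [set p : m.-tuple 'I_k * m.-tuple 'I_k | overlapping m p.1 p.2].
pose X := ((n - 2 * m).-tuple 'I_k * (n - 2 * m).-tuple 'I_k)%type.
(* [t.1.1] holds the end of the first word and the start of the second, [t.1.2] the end of the
   second and the start of the first, [t.2] the two free middles. *)
pose f (t : (m.-tuple 'I_k * m.-tuple 'I_k) * (m.-tuple 'I_k * m.-tuple 'I_k) * X) :=
  (tcast e (cat_tuple t.1.2.2 (cat_tuple t.2.1 t.1.1.1)),
   tcast e (cat_tuple t.1.1.2 (cat_tuple t.2.2 t.1.2.1))).
have f_inj : injective f.
  move=> [[[a b] [c d]] [y z]] [[[a' b'] [c' d']] [y' z']].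
  case=> /(congr1 (@tval _ _)) + /(congr1 (@tval _ _)).
  rewrite !val_tcast /= => /eqP + /eqP.
  rewrite !eqseq_cat ?size_tuple //.
  move=> /and3P[/eqP dE /eqP yE /eqP aE] /and3P[/eqP bE /eqP zE /eqP cE].
  by congr ((_, _), (_, _), (_, _)); apply: val_inj.
transitivity #|f @: setX (setX W W) [set: X]|; last first.
  rewrite card_imset // !cardsX cardsT card_prod !card_word.
  by rewrite [in RHS]mul2n -addnn expnD.
apply: eq_card => -[u v]; rewrite !inE /=.
have su := size_tuple u; have sv := size_tuple v.
have endsE (u' v' : n.-tuple 'I_k) :
    overlapping m u' v' = overlapping m (drop (n - m) u') (take m v').
  by rewrite overlapping_ends ?size_tuple //; lia.
rewrite (endsE u v) (endsE v u).
have splitE (t : n.-tuple 'I_k) :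
    t = take m t ++ take (n - 2 * m) (drop m t) ++ drop (n - m) t :> seq _.
  rewrite -[LHS](cat_take_drop m); congr (_ ++ _).
  rewrite -[LHS](cat_take_drop (n - 2 * m)) drop_drop; congr (_ ++ drop _ _); lia.
have sp (t : n.-tuple 'I_k) : size (take m t) == m.
  by rewrite size_takel // size_tuple; lia.
have sm (t : n.-tuple 'I_k) : size (take (n - 2 * m) (drop m t)) == n - 2 * m.
  by rewrite size_takel // size_drop size_tuple; lia.
have ss (t : n.-tuple 'I_k) : size (drop (n - m) t) == m.
  by rewrite size_drop size_tuple; apply/eqP; lia.
apply/idP/imsetP => [/andP[ouv ovu]|[[[[a b] [c d]] [y z]]]].
  exists ((Tuple (ss u), Tuple (sp v)), (Tuple (ss v), Tuple (sp u)),
          (Tuple (sm u), Tuple (sm v))).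
    by rewrite !inE /= ouv ovu.
  by congr (_, _); apply: val_inj; rewrite /= val_tcast /= -splitE.
rewrite !inE andbT /= => /andP[oab ocd] [uE vE].
have takeE (t1 t3 : m.-tuple 'I_k) (t2 : (n - 2 * m).-tuple 'I_k) :
    take m (t1 ++ t2 ++ t3) = t1 by rewrite take_size_cat ?size_tuple.
have dropE (t1 t3 : m.-tuple 'I_k) (t2 : (n - 2 * m).-tuple 'I_k) :
    drop (n - m) (t1 ++ t2 ++ t3) = t3.
  by rewrite catA drop_size_cat // size_cat !size_tuple; lia.
by rewrite uE vE !val_tcast /= !takeE !dropE oab.
Qed.

Lemma mutually_borderedE n (u v : n.-tuple 'I_k) :
  `[< mutually_bordered u v >] = overlapping n.-1 u v && overlapping n.-1 v u.
Proof.
have [su sv] := (size_tuple u, size_tuple v).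
apply/asboolP/andP => [[uv [y /and3P[y0 yu yv]]]|].
  split; first exact/(proper_overlapP su sv).
  by apply/(proper_overlapP sv su); exists y; apply/and3P.
move=> [/(proper_overlapP su sv) uv /(proper_overlapP sv su)[y /and3P[y0 yv yu]]].
by split=> //; exists y; apply/and3P.
Qed.

(** With [m < n], every overlap of length at most [m] is proper. *)
Lemma num_mutually_bordered_ge n m : m < n -> 2 * m <= n ->
  #|[set p : m.-tuple 'I_k * m.-tuple 'I_k | overlapping m p.1 p.2]| ^ 2
    * k ^ (2 * (n - 2 * m)) <= num_mutually_bordered k n.
Proof.
move=> mn m2n; rewrite -card_mutually_overlapping //.
apply/subset_leq_card/subsetP => -[u v]; rewrite !inE /= => /andP[ouv ovu].
have mn1 : m <= n.-1 by lia.
by rewrite mutually_borderedE (overlapping_mono mn1 ouv) (overlapping_mono mn1 ovu).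
Qed.

(** A union bound: either both directions have an overlap of length at most [m], or one direction
    has only longer ones. The subtracted count stands on the left to avoid truncated subtraction. *)
Lemma num_mutually_bordered_le n m : 2 * m <= n ->
  num_mutually_bordered k n
    + 2 * #|[set p : n.-tuple 'I_k * n.-tuple 'I_k | overlapping m p.1 p.2]|
  <= #|[set p : m.-tuple 'I_k * m.-tuple 'I_k | overlapping m p.1 p.2]| ^ 2
       * k ^ (2 * (n - 2 * m))
     + 2 * #|[set p : n.-tuple 'I_k * n.-tuple 'I_k | overlapping n p.1 p.2]|.
Proof.
move=> m2n; rewrite -card_mutually_overlapping //.
set A := [set p | _ && _].
pose W r := [set p : n.-tuple 'I_k * n.-tuple 'I_k | overlapping r p.1 p.2].
pose V r := [set p : n.-tuple 'I_k * n.-tuple 'I_k | overlapping r p.2 p.1].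
(* Exchanging the two words carries one direction of overlap to the other. *)
have cardV r : #|V r| = #|W r|.
  pose swap (p : n.-tuple 'I_k * n.-tuple 'I_k) := (p.2, p.1).
  have swapK : involutive swap by case.
  rewrite -(card_imset (W r) (inv_inj swapK)); apply: eq_card => p.
  rewrite -[p in RHS]swapK mem_imset ?inE //; exact: inv_inj.
rewrite -!/(W _).
have WD : #|W n :\: W m| + #|W m| = #|W n|.
  rewrite addnC -(cardsID (W m) (W n)) (setIidPr _) //.
  by apply/subsetP => p; rewrite !inE; apply: overlapping_mono; lia.
have VD : #|V n :\: V m| + #|V m| = #|V n|.
  rewrite addnC -(cardsID (V m) (V n)) (setIidPr _) //.
  by apply/subsetP => p; rewrite !inE; apply: overlapping_mono; lia.
have : num_mutually_bordered k n <= #|A :|: (W n :\: W m) :|: (V n :\: V m)|.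
  apply/subset_leq_card/subsetP => -[u v].
  rewrite !inE /= mutually_borderedE => /andP[ouv ovu].
  rewrite (overlapping_mono (leq_pred n) ouv) (overlapping_mono (leq_pred n) ovu).
  by case: (overlapping m u v); case: (overlapping m v u).
have := leq_card_setU (A :|: (W n :\: W m)) (V n :\: V m).
have := leq_card_setU A (W n :\: W m).
rewrite !cardV in VD; move=> [h1 _] [h2 _]; lia.
Qed.

End Counting.

Unset Implicit Arguments.
Set Strict Implicit.

From mathcomp Require Import all_classical all_reals all_analysis.
From mathcomp Require Import ring lra.
Import Order.TTheory GRing.Theory Num.Theory.
Import numFieldNormedType.Exports.

Local Open Scope classical_set_scope.
Local Open Scope ring_scope.

(** * Densities, the limit and its bounds *)

Section Density.
Variables (R : realType) (k : nat).
Hypothesis k_ge2 : (2 <= k)%N.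

Definition unbordered_sum (n : nat) : R :=
  \sum_(1 <= i < n.+1) (num_unbordered k i)%:R * k%:R ^- (2 * i).

Lemma unbordered_sumS n : unbordered_sum n.+1 =
  unbordered_sum n + (num_unbordered k n.+1)%:R * k%:R ^- (2 * n.+1).
Proof. by rewrite /unbordered_sum big_nat_recr. Qed.

Lemma unbordered_sum_ge0 n : 0 <= unbordered_sum n.
Proof. by apply: sumr_ge0 => i _; rewrite divr_ge0 ?exprn_ge0. Qed.

Lemma unbordered_sum_nondecreasing :
  nondecreasing_seq (unbordered_sum : R ^nat).
Proof.
apply/nondecreasing_seqP => n.
by rewrite unbordered_sumS lerDl divr_ge0 ?exprn_ge0.
Qed.

Let kR_gt0 : 0 < k%:R :> R. Proof. by rewrite ltr0n; lia. Qed.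
Let kR_neq0 : k%:R != 0 :> R. Proof. by rewrite gt_eqF. Qed.
Let kR1_gt0 : 0 < k%:R - 1 :> R. Proof. by rewrite subr_gt0 ltr1n. Qed.

(** Since u_(n+1) is at most k^(n+1), the new term is at most k^-(n+1), which is exactly the drop of
    the geometric tail k^-n / (k-1) from n to n+1. *)
Lemma unbordered_sum_tail_nonincreasing : nonincreasing_seq
  ((fun n => unbordered_sum n + k%:R ^- n / (k%:R - 1)) : R ^nat).
Proof.
apply/nonincreasing_seqP => n; rewrite unbordered_sumS -addrA lerD2l.
have le1 : (num_unbordered k n.+1)%:R * k%:R ^- (2 * n.+1) <= k%:R ^- n.+1 :> R.
  rewrite ler_pdivrMr ?exprn_gt0 // mul2n -addnn exprD mulKf ?expf_neq0 //.
  by rewrite -natrX ler_nat num_unbordered_le.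
have -> : k%:R ^- n / (k%:R - 1) = k%:R ^- n.+1 + k%:R ^- n.+1 / (k%:R - 1) :> R.
  rewrite exprS; field.
  by rewrite expf_neq0 // kR_neq0 gt_eqF.
by rewrite lerD2r.
Qed.

(** Increasing lower estimates stay below decreasing upper ones, whatever the indices. This yields
    both the convergence of the series and the upper bound on its limit. *)
Lemma unbordered_sum_le m n :
  unbordered_sum m <= unbordered_sum n + k%:R ^- n / (k%:R - 1).
Proof.
have tail_ge0 i : 0 <= k%:R ^- i / (k%:R - 1) :> R.
  by rewrite divr_ge0 ?invr_ge0 ?exprn_ge0 // ltW.
have [mn|/ltnW nm] := leqP m n.
  by apply: (le_trans (unbordered_sum_nondecreasing _ _ mn)); rewrite lerDl.
apply: le_trans (unbordered_sum_tail_nonincreasing _ _ nm).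
by rewrite lerDl.
Qed.

Lemma cvg_unbordered_sum : unbordered_sum @ \oo --> limn unbordered_sum.
Proof.
apply: nondecreasing_is_cvgn; first exact: unbordered_sum_nondecreasing.
by exists (unbordered_sum 0 + k%:R ^- 0 / (k%:R - 1)) => _ [m _ <-];
  exact: unbordered_sum_le.
Qed.

Lemma overlapping_density n m : (m <= n)%N ->
  #|[set p : n.-tuple 'I_k * n.-tuple 'I_k | overlapping m p.1 p.2]%SET|%:R
  = unbordered_sum m * k%:R ^+ (2 * n) :> R.
Proof.
move=> mn; rewrite card_overlapping // natr_sum mulr_suml.
apply: eq_big_nat => i /andP[_ im]; rewrite natrM natrX -mulrA; congr (_ * _).
(* As [i <= n], the power k^(2(n-i)) is the quotient of k^(2n) by k^(2i). *)
rewrite mulrC -exprB ?unitfE // ?mulnBr //; lia.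
Qed.

(** The square contributes k^(4m), and the 2(n-2m) free middle letters complete it to k^(2n). *)
Lemma mutual_overlap_density n m : (2 * m <= n)%N ->
  (#|[set p : m.-tuple 'I_k * m.-tuple 'I_k | overlapping m p.1 p.2]%SET| ^ 2
    * k ^ (2 * (n - 2 * m)))%:R
  = unbordered_sum m ^+ 2 * k%:R ^+ (2 * n) :> R.
Proof.
move=> m2n; rewrite natrM !natrX overlapping_density // exprMn -exprM -mulrA.
by rewrite -exprD; congr (_ * _ ^+ _); lia.
Qed.

Lemma mutually_bordered_density_ge n m : (m < n)%N -> (2 * m <= n)%N ->
  unbordered_sum m ^+ 2 <= (num_mutually_bordered k n)%:R / k%:R ^+ (2 * n).
Proof.
move=> mn m2n; rewrite ler_pdivlMr ?exprn_gt0 // -mutual_overlap_density //.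
by rewrite ler_nat num_mutually_bordered_ge.
Qed.

Lemma mutually_bordered_density_le n m : (2 * m <= n)%N ->
  (num_mutually_bordered k n)%:R / k%:R ^+ (2 * n)
  <= unbordered_sum m ^+ 2 + 2 * (unbordered_sum n - unbordered_sum m).
Proof.
move=> m2n; rewrite ler_pdivrMr ?exprn_gt0 //.
have := num_mutually_bordered_le k m2n; rewrite -(ler_nat R).
rewrite natrD natrM overlapping_density; last lia.
rewrite natrD mutual_overlap_density // natrM overlapping_density //.
lra.
Qed.

Lemma cvg_half : n./2 @[n --> \oo] --> \oo.
Proof.
move=> A [N _ NA]; exists (2 * N)%N => // n /= Nn; apply: NA => /=.
by lia.
Qed.

(** Squeeze with [m = n./2]: both m and n tend to infinity, so the error 2 (S_n - S_m) vanishes. *)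
Lemma cvg_mutually_bordered_density :
  ((num_mutually_bordered k n)%:R / k%:R ^+ (2 * n) : R) @[n --> \oo]
    --> limn unbordered_sum ^+ 2.
Proof.
have cvgS := cvg_unbordered_sum.
have cvgS2 : unbordered_sum n./2 @[n --> \oo] --> limn unbordered_sum.
  exact: cvg_comp cvg_half cvgS.
have cvg_sq : unbordered_sum n./2 ^+ 2 @[n --> \oo] --> limn unbordered_sum ^+ 2.
  by rewrite expr2; under eq_fun do rewrite expr2; apply: cvgM.
apply: (squeeze_cvgr _ cvg_sq); last first.
  (* The limit is rewritten in the shape of the upper bound, with a vanishing second term. *)
  have -> : limn unbordered_sum ^+ 2 =
      limn unbordered_sum ^+ 2 + 2 * (limn unbordered_sum - limn unbordered_sum).
    by rewrite subrr mulr0 addr0.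
  apply: cvgD cvg_sq _; apply: cvgM; first exact: cvg_cst.
  exact: cvgB cvgS cvgS2.
(* Positivity of [n] gives [n./2 < n], as the lower bound requires. *)
near=> n; have n0 : (0 < n)%N by near: n; exact: nbhs_infty_gt.
by rewrite mutually_bordered_density_ge ?mutually_bordered_density_le //; lia.
Unshelve. all: by end_near.
Qed.

End Density.

Theorem theorem10 (R : realType) (k : nat) (hk : (2 <= k)%N) :
  exists L : R,
    ((num_mutually_bordered k n)%:R / k%:R ^+ (2 * n) : R) @[n --> \oo] --> L
    /\ forall n : nat, (1 <= n)%N ->
      (\sum_(1 <= i < n.+1) (num_unbordered k i)%:R * k%:R ^- (2 * i)) ^+ 2
        <= L
        <= ((\sum_(1 <= i < n.+1) (num_unbordered k i)%:R * k%:R ^- (2 * i))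
            + k%:R ^- n / (k%:R - 1)) ^+ 2.
Proof.
exists (limn (unbordered_sum R k) ^+ 2); split.
  exact: cvg_mutually_bordered_density.
move=> n _; rewrite -/(unbordered_sum R k n).
have cvgS := @cvg_unbordered_sum R k hk.
(* Here [n] is fixed and the index [m] of the partial sum tends to infinity. *)
have ub : limn (unbordered_sum R k)
          <= unbordered_sum R k n + k%:R ^- n / (k%:R - 1).
  by apply: limr_le; [exact: cvgS | apply: nearW => m; exact: unbordered_sum_le].
have lb : unbordered_sum R k n <= limn (unbordered_sum R k).
  by apply: nondecreasing_cvgn_le; [exact: unbordered_sum_nondecreasing | exact: cvgS].
have S0 := @unbordered_sum_ge0 R k n.
(* Squaring preserves the inequalities because all three quantities are at least S_n, which is
   nonnegative. *)
by rewrite !lerXn2r // nnegrE ?(le_trans S0) // (le_trans lb).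
Qed.
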